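(* Let $F,G$ be fixed graphs with $\mathrm{ex}_F(n,G)=\frac{n^2}{v(F)^2}+o(n^2)$ as $n\to\infty$, and let $s$ be a positive integer. (1) If $F(s)$ can be decomposed into $s^2$ edge-disjoint copies of $F$, then $\mathrm{ex}_{F(s)}(n,G)=\frac{n^2}{v(F(s))^2}+o(n^2)$. (2) Specifically, if $s$ is a prime with $v(F)\le s$, then $\mathrm{ex}_{F(s)}(n,G)=\frac{n^2}{v(F(s))^2}+o(n^2)$.
   Context: All graphs are finite and simple; $v(F)$ is the number of vertices of $F$. The $s$-blow-up $F(s)$ of $F$ is obtained by replacing each vertex $v$ of $F$ by a set $X_v$ of $s$ vertices (the sets being disjoint and independent) and joining every vertex of $X_u$ to every vertex of $X_v$ exactly when $uv\in E(F)$; thus $v(F(s))=s\,v(F)$. For graphs $F$ and $G$, the $F$-multicolor Turán number $\mathrm{ex}_F(n,G)$ is the maximum number of pairwise edge-disjoint copies of $F$ on a common vertex set of $n$ vertices such that the union of these copies contains no copy of $G$ whose edges all come from pairwise distinct copies of $F$ in the family (that is, giving each chosen copy of $F$ its own color, there is no rainbow copy of $G$). *)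

(* Defs.v *)
From mathcomp Require Import all_boot all_order all_algebra.
From mathcomp Require Import boolp classical_sets reals topology normedtype landau.

Set Implicit Arguments.
Unset Strict Implicit.
Unset Printing Implicit Defensive.

Import Order.TTheory GRing.Theory Num.Theory.
Import numFieldNormedType.Exports.

Record sgraph := SGraph {
  vertex :> finType;
  adj : rel vertex;
  adj_sym : symmetric adj;
  adj_irr : irreflexive adj
}.

Definition nverts (F : sgraph) : nat := #|{: F}|.

Definition edges (F : sgraph) : {set {set F}} :=
  [set [set p.1; p.2] | p : F * F & adj p.1 p.2].

Section BlowUp.
Variables (F : sgraph) (s : nat).

(* The class X_v is the set of pairs (v, i) with i : 'I_s. *)
Definition blowup_adj : rel (F * 'I_s) := fun x y => adj x.1 y.1.

Lemma blowup_adj_sym : symmetric blowup_adj.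
Proof. by move=> x y; apply: adj_sym. Qed.

Lemma blowup_adj_irr : irreflexive blowup_adj.
Proof. by move=> x; apply: adj_irr. Qed.

Definition blowup : sgraph := SGraph blowup_adj_sym blowup_adj_irr.

End BlowUp.

(* A subgraph of the complete graph on T: its vertex set and its edge set.
   Keeping the vertex set matters only for graphs with isolated vertices. *)
Notation subgraph T := ({set T} * {set {set T}})%type.

Definition sub_edges (T : finType) (A : subgraph T) : {set {set T}} := A.2.

Definition image_of (F : sgraph) (T : finType) (f : F -> T) : subgraph T :=
  ([set f x | x : F], [set f @: e | e : {set F} in edges F]).

Definition copies (F : sgraph) (T : finType) : {set subgraph T} :=
  [set image_of f | f : {ffun F -> T} & injectiveb f].

Definition edge_disjoint (T : finType) (C : {set subgraph T}) : bool :=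
  [forall A in C, forall B in C,
     (A != B) ==> [disjoint sub_edges A & sub_edges B]].

Definition union_edges (T : finType) (C : {set subgraph T}) : {set {set T}} :=
  \bigcup_(A in C) sub_edges A.

(* The members of C are the colors; the coloring c chooses for every edge of B
   a member of C containing it, and these members are pairwise distinct. *)
Definition rainbow (T : finType) (C : {set subgraph T}) (B : subgraph T) : bool :=
  [exists c : {ffun {set T} -> subgraph T},
     [forall e in sub_edges B, (c e \in C) && (e \in sub_edges (c e))]
     && dinjectiveb c (sub_edges B)].

Definition ex_family (F G : sgraph) (T : finType) (C : {set subgraph T}) : bool :=
  [&& C \subset copies F T, edge_disjoint C
    & ~~ [exists B in copies G T, rainbow C B]].

Definition ex_multi (F G : sgraph) (n : nat) : nat :=
  \max_(C : {set subgraph 'I_n} | ex_family F G C) #|C|.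

Definition decomposable (H F : sgraph) (k : nat) : Prop :=
  exists D : {set subgraph H},
    [/\ D \subset copies F H, edge_disjoint D, #|D| = k
      & union_edges D = edges H].

Local Open Scope classical_set_scope.
Local Open Scope ring_scope.

Definition ex_multi_minimal (R : realType) (F G : sgraph) : Prop :=
  forall n : nat, ((ex_multi F G n)%:R : R)
    = (n%:R ^+ 2 / (nverts F)%:R ^+ 2 : R) +o_(n \near \oo) (n%:R ^+ 2 : R).

(* Main.v *)
Require Import Defs.
From mathcomp Require Import boolp functions topology normedtype landau.
From mathcomp Require Import all_boot all_order all_algebra reals.
From mathcomp Require Import ring lra zify.

(** Let C be an edge-disjoint family of copies of H on n vertices without a
    rainbow G. A homomorphism from G to the union of C that is not a rainbow copy
    identifies two vertices or sends two edges into one member of C; in both cases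
    the image of one vertex of G is determined up to O(1) choices by the images of
    the others, so there are only O(n^(v(G)-1)) homomorphisms. By the graph removal
    lemma, deleting o(n^2) members of C destroys all of them.

    For H = F(s), cutting each remaining copy of F(s) into s^2 copies of F gives
    s^2 ex_{F(s)}(n,G) <= ex_F(n,G) + o(n^2). For H = F, blowing up each remaining
    copy of F by s gives ex_{F(s)}(sm,G) >= ex_F(m,G) - o(m^2): a copy of G in the
    blown-up union would project to a homomorphism. Edgeless F is degenerate: the
    hypothesis then fails unless F has no vertex. For (2), the s^2 copies of F in
    F(s) are the lines x |-> (x, i + j x) over the field with s elements. *)

Set Implicit Arguments.
Unset Strict Implicit.
Unset Printing Implicit Defensive.

Import Order.TTheory GRing.Theory Num.Theory.
Import numFieldNormedType.Exports.

Local Open Scope ring_scope.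

(** * Szemeredi's regularity lemma *)

Section Regularity.
Variables (R : realFieldType) (T : finType) (e : rel T).

Definition cell (K : finType) (p : T -> K) (a : K) : {set T} :=
  [set x | p x == a].

Definition nedges (A B : {set T}) : R :=
  \sum_(x in A) \sum_(y in B) (e x y)%:R.

Definition dens (A B : {set T}) : R := nedges A B / (#|A|%:R * #|B|%:R).

(** The deviation is measured against [#|A| * #|B|], not [#|X| * #|Y|], so [X] and [Y] may be
    arbitrarily small: this is regularity in the cut norm. *)
Definition regular (eps : R) (A B : {set T}) : bool :=
  [forall X : {set T}, forall Y : {set T}, (X \subset A) && (Y \subset B) ==>
    (`|nedges X Y - dens A B * (#|X|%:R * #|Y|%:R)| <=
       eps * (#|A|%:R * #|B|%:R))].

Definition condexp (K : finType) (p : T -> K) (x y : T) : R :=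
  dens (cell p (p x)) (cell p (p y)).

Definition energy (K : finType) (p : T -> K) : R :=
  \sum_x \sum_y condexp p x y ^+ 2.

Lemma nedges_ge0 A B : 0 <= nedges A B.
Proof. by do 2!(apply: sumr_ge0 => ? _). Qed.

Lemma nedges_le A B : nedges A B <= #|A|%:R * #|B|%:R.
Proof.
rewrite mulr_natl -sumr_const; apply: ler_sum => x _.
by rewrite -sumr_const; apply: ler_sum => y _; rewrite lern1 leq_b1.
Qed.

(** For an empty set [dens] divides by zero and is 0; the identity survives because [nedges] then
    vanishes too. *)
Lemma densM A B : dens A B * (#|A|%:R * #|B|%:R) = nedges A B.
Proof.
rewrite /dens; have [AB0|?] := eqVneq (#|A|%:R * #|B|%:R : R) 0; last exact: divfK.
by rewrite AB0 mulr0; apply/le_anti; rewrite nedges_ge0 -AB0 nedges_le.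
Qed.

Lemma dens_ge0 A B : 0 <= dens A B.
Proof. by rewrite divr_ge0 ?nedges_ge0 ?mulr_ge0. Qed.

Lemma dens_le1 A B : dens A B <= 1.
Proof.
rewrite /dens; have [->|AB0] := eqVneq (#|A|%:R * #|B|%:R : R) 0.
  by rewrite invr0 mulr0.
by rewrite ler_pdivrMr ?mul1r ?nedges_le // lt_def AB0 mulr_ge0.
Qed.

Lemma sum_cells (K : finType) (p : T -> K) (F : T -> T -> R) :
  \sum_x \sum_y F x y =
  \sum_a \sum_b \sum_(x in cell p a) \sum_(y in cell p b) F x y.
Proof.
rewrite (partition_big p predT) //=; apply: eq_bigr => a _.
rewrite exchange_big /= (partition_big p predT) //=; apply: eq_bigr => b _.
rewrite exchange_big /=; apply: eq_big => [x|x _]; first by rewrite inE.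
by apply: eq_bigl => y; rewrite inE.
Qed.

(** A factor that is constant on cells cannot distinguish [e] from its average over a pair of
    cells. *)
Lemma sum_condexp (K : finType) (p : T -> K) (h : K -> K -> R) :
  \sum_x \sum_y condexp p x y * h (p x) (p y) =
  \sum_x \sum_y (e x y)%:R * h (p x) (p y).
Proof.
rewrite (sum_cells p) [RHS](sum_cells p).
apply: eq_bigr => a _; apply: eq_bigr => b _.
transitivity (nedges (cell p a) (cell p b) * h a b).
  rewrite -densM mulrAC [_ * h a b]mulrC mulrA.
  under eq_bigr => x /[!inE]/eqP xa.
    under eq_bigr => y /[!inE]/eqP yb do rewrite /condexp xa yb mulrC.
    rewrite sumr_const -mulr_natr; over.
  by rewrite sumr_const -mulr_natr; ring.
rewrite mulr_suml; apply: eq_bigr => x /[!inE]/eqP ->.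
by rewrite mulr_suml; apply: eq_bigr => y /[!inE]/eqP ->.
Qed.

Lemma energy_le (K : finType) (p : T -> K) : energy p <= #|T|%:R ^+ 2.
Proof.
rewrite /energy expr2 mulr_natl -sumr_const; apply: ler_sum => x _.
rewrite -sumr_const; apply: ler_sum => y _.
by rewrite expr_le1 ?dens_le1 ?dens_ge0.
Qed.

Lemma energy_ge0 (K : finType) (p : T -> K) : 0 <= energy p.
Proof. by do 2!(apply: sumr_ge0 => ? _); apply: sqr_ge0. Qed.

(* Conditional expectation is an orthogonal projection, hence Pythagoras. *)
Lemma energy_refine (K K' : finType) (r : K' -> K) (p' : T -> K') :
  let p := r \o p' in
  \sum_x \sum_y (condexp p' x y - condexp p x y) ^+ 2 = energy p' - energy p.
Proof.
move=> p; have E1 := sum_condexp p (fun a b => dens (cell p a) (cell p b)).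
have E2 := sum_condexp p' (fun a b => dens (cell p (r a)) (cell p (r b))).
have {E1 E2} E : \sum_x \sum_y condexp p' x y * condexp p x y = energy p.
  rewrite /energy -[LHS]/(\sum_x \sum_y condexp p' x y *
    dens (cell p (r (p' x))) (cell p (r (p' y)))) E2.
  rewrite -[LHS]/(\sum_x \sum_y (e x y)%:R *
    dens (cell p (p x)) (cell p (p y))) -E1.
  by apply: eq_bigr => x _; apply: eq_bigr => y _; rewrite expr2.
transitivity (energy p' + energy p
   - 2 * \sum_x \sum_y condexp p' x y * condexp p x y); last by rewrite E; ring.
rewrite /energy mulr_sumr -big_split -sumrB /=; apply: eq_bigr => x _.
rewrite mulr_sumr -big_split -sumrB /=; apply: eq_bigr => y _.
by ring.
Qed.

(** Pairs of cells are weighted by the number of pairs of points in them, so the cells need not have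
    equal size. *)
Definition irregular_mass (eps : R) (K : finType) (p : T -> K) : R :=
  \sum_a \sum_b (if regular eps (cell p a) (cell p b) then 0
                 else #|cell p a|%:R * #|cell p b|%:R).

Definition witness (eps : R) (A B : {set T}) : {set T} * {set T} :=
  odflt (set0, set0) [pick XY : {set T} * {set T} |
    [&& XY.1 \subset A, XY.2 \subset B &
     eps * (#|A|%:R * #|B|%:R) <
     `|nedges XY.1 XY.2 - dens A B * (#|XY.1|%:R * #|XY.2|%:R)|]].

Lemma witnessP eps A B : ~~ regular eps A B ->
  let: (X, Y) := witness eps A B in
  [/\ X \subset A, Y \subset B &
     eps * (#|A|%:R * #|B|%:R) <
     `|nedges X Y - dens A B * (#|X|%:R * #|Y|%:R)|].
Proof.
rewrite negb_forall => /existsP[X]; rewrite negb_forall => /existsP[Y].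
rewrite negb_imply -ltNge => /andP[/andP[XA YB] XY].
rewrite /witness; case: pickP => [[X' Y'] /and3P[//]|/(_ (X, Y))].
by rewrite /= XA YB XY.
Qed.

Definition refine_type (K : finType) : finType :=
  (K * ({ffun K -> bool} * {ffun K -> bool}))%type.

(** Pairs of cells are ordered, so [x] records its membership both in left witnesses, against every
    [b], and in right witnesses, against every [a]. For a regular pair [witness] is a pair of empty
    sets and splits nothing. *)
Definition refine (eps : R) (K : finType) (p : T -> K) (x : T) : refine_type K :=
  (p x,
   ([ffun b => x \in (witness eps (cell p (p x)) (cell p b)).1],
    [ffun a => x \in (witness eps (cell p a) (cell p (p x))).2])).

(* With [lam = +- eps] the pointwise bound [2 lam g - lam ^ 2 <= g ^ 2] replaces
   Cauchy-Schwarz. *)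
Lemma sum_sqr_ge (eps : R) (A B X Y : {set T}) (g : T -> T -> R) :
    0 < eps -> X \subset A -> Y \subset B ->
    eps * (#|A|%:R * #|B|%:R) <= `|\sum_(x in X) \sum_(y in Y) g x y| ->
  eps ^+ 2 * (#|A|%:R * #|B|%:R) <= \sum_(x in A) \sum_(y in B) g x y ^+ 2.
Proof.
move=> eps0 XA YB hg; set S := \sum_(x in X) _ in hg.
pose lam := if 0 <= S then eps else - eps.
have lamS : lam * S = eps * `|S|.
  by rewrite /lam; case: ger0P => _; rewrite ?mulrN ?mulNr ?opprK.
have lam2 : lam ^+ 2 = eps ^+ 2 by rewrite /lam; case: ifP; rewrite ?sqrrN.
have le1 : \sum_(x in X) \sum_(y in Y) (2 * lam * g x y - lam ^+ 2) <=
           \sum_(x in A) \sum_(y in B) g x y ^+ 2.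
  have sub (U V : {set T}) (F : T -> R) : U \subset V -> (forall x, 0 <= F x) ->
      \sum_(x in U) F x <= \sum_(x in V) F x.
    move=> UV F0; rewrite [leRHS](big_setID U) /= (setIidPr UV).
    by rewrite lerDl sumr_ge0.
  apply: le_trans (_ : \sum_(x in X) \sum_(y in B) g x y ^+ 2 <= _).
    apply: ler_sum => x _; apply: le_trans (sub _ _ _ YB _); last first.
      by move=> y; apply: sqr_ge0.
    by apply: ler_sum => y _; have := sqr_ge0 (g x y - lam); lra.
  by apply: sub => // x; apply: sumr_ge0 => y _; apply: sqr_ge0.
apply: le_trans le1.
have -> : \sum_(x in X) \sum_(y in Y) (2 * lam * g x y - lam ^+ 2) =
          2 * (lam * S) - eps ^+ 2 * (#|X|%:R * #|Y|%:R).
  rewrite /S !mulr_sumr -lam2 [lam ^+ 2 * _]mulrC -[_ * lam ^+ 2]mulrA.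
  rewrite [#|X|%:R * _]mulr_natl -sumr_const -sumrB; apply: eq_bigr => x _.
  rewrite !mulr_sumr [#|Y|%:R * _]mulr_natl -sumr_const -sumrB.
  by apply: eq_bigr => y _; rewrite mulrA.
have XYAB : #|X|%:R * #|Y|%:R <= #|A|%:R * #|B|%:R :> R.
  by rewrite ler_pM // ler_nat subset_leq_card.
rewrite lamS; have := ler_wpM2l (sqr_ge0 eps) XYAB.
have := ler_wpM2l (ltW eps0) hg.
by lra.
Qed.

(** By Pythagoras the gain is the squared distance of the two conditional expectations. On an
    irregular pair the witness rectangle is a union of refined cell pairs, so their difference sums
    over it to the discrepancy, and [sum_sqr_ge] applies. *)
Lemma energy_increment (eps : R) (K : finType) (p : T -> K) : 0 < eps ->
  energy p + eps ^+ 2 * irregular_mass eps p <= energy (refine eps p).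
Proof.
move=> eps0; rewrite addrC -lerBrDr.
rewrite -(@energy_refine K (refine_type K) fst (refine eps p)) /=.
rewrite (sum_cells p) mulr_sumr; apply: ler_sum => a _.
rewrite mulr_sumr; apply: ler_sum => b _.
case: ifPn => [_|irr].
  by rewrite mulr0; do 2!(apply: sumr_ge0 => ? _); apply: sqr_ge0.
have := witnessP irr; case E: (witness _ _ _) => [X Y] [XA YB XY].
apply: (sum_sqr_ge eps0 XA YB); apply: (le_trans (ltW XY)).
rewrite le_eqVlt; apply/orP; left; apply/eqP; congr (`| _ |).
under eq_bigr do rewrite sumrB.
rewrite sumrB; congr (_ - _); last first.
  rewrite mulrCA mulr_natl -sumr_const; apply: eq_bigr => x xX.
  rewrite mulr_natr -sumr_const; apply: eq_bigr => y yY.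
  have /[!inE]/eqP xa := subsetP XA _ xX.
  have /[!inE]/eqP yb := subsetP YB _ yY.
  by rewrite /condexp /= xa yb.
(* The indicator of the rectangle [X] times [Y], read off the refined labels; [sum_condexp] can then
   replace the refined averages by [e]. *)
pose h (u v : refine_type K) : R :=
  [&& u.1 == a, v.1 == b, u.2.1 b & v.2.2 a]%:R.
have hE x y : h (refine eps p x) (refine eps p y) = ((x \in X) && (y \in Y))%:R.
  rewrite /h /= !ffunE; congr (nat_of_bool _)%:R.
  case: eqP => [->|xa]; last first.
    by apply/esym/negbTE/andP => -[/(subsetP XA)] /[!inE] /eqP.
  case: eqP => [->|yb]; first by rewrite E.
  by apply/esym/negbTE/andP => -[_ /(subsetP YB)] /[!inE] /eqP.
have := sum_condexp (refine eps p) h.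
have hsum (F : T -> T -> R) :
    \sum_x \sum_y F x y * h (refine eps p x) (refine eps p y) =
    \sum_(x in X) \sum_(y in Y) F x y.
  rewrite [RHS]big_mkcond; apply: eq_bigr => x _.
  under eq_bigr do rewrite hE.
  case: (x \in X) => /=; last by apply: big1 => y _; rewrite mulr0.
  by rewrite [RHS]big_mkcond; apply: eq_bigr => y _; case: ifP; rewrite (mulr1, mulr0).
by rewrite !hsum => ->.
Qed.

Lemma card_refine_type (K : finType) :
  #|refine_type K| = (#|K| * (2 ^ #|K| * 2 ^ #|K|))%N.
Proof. by rewrite !card_prod !card_ffun card_bool. Qed.

End Regularity.

Definition regularity_bound (j : nat) : nat :=
  iter j (fun m => m * (2 ^ m * 2 ^ m))%N 1%N.

(** Every refinement of a partition with too much irregular mass raises the energy by at least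
    [eps ^+ 3 * #|T| ^ 2]. As the energy never exceeds [#|T| ^ 2], fewer than [j] refinements are
    possible once [j * eps ^+ 3 > 1]. *)
Lemma szemeredi (R : archiRealFieldType) (eps : R) : 0 < eps ->
  exists M : nat, forall (T : finType) (e : rel T),
    exists (K : finType) (p : T -> K),
      (#|K| <= M)%N /\ irregular_mass e eps p <= eps * #|T|%:R ^+ 2.
Proof.
move=> eps0; have eps3 : 0 < eps ^+ 3 by apply: exprn_gt0.
pose j := Num.bound (eps ^- 3).
have hj : 1 < j%:R * eps ^+ 3.
  by rewrite -ltr_pdivrMr // div1r archi_boundP // invr_ge0 ltW.
exists (\max_(i < j.+1) regularity_bound i)%N => T e.
have [n0|n0] := posnP #|T|.
  have p : T -> unit by move=> x.
  exists unit, p; split.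
    by rewrite card_unit (leq_trans _ (leq_bigmax ord0)).
  rewrite n0 expr0n mulr0 le_eqVlt; apply/orP; left; apply/eqP.
  apply: big1 => a _; apply: big1 => b _; case: ifP => // _.
  suff -> : #|cell p a| = 0%N by rewrite mul0r.
  by apply/eqP; rewrite -leqn0 -n0 max_card.
have IH i : (i <= j)%N ->
    (exists (K : finType) (p : T -> K),
      (#|K| <= \max_(i < j.+1) regularity_bound i)%N /\
      irregular_mass e eps p <= eps * #|T|%:R ^+ 2) \/
    (exists (K : finType) (p : T -> K), #|K| = regularity_bound i /\
      i%:R * eps ^+ 3 * #|T|%:R ^+ 2 <= energy R e p).
  elim: i => [_|i IH ij].
    right; exists unit, (fun=> tt); rewrite card_unit; split=> //.
    by rewrite !mul0r energy_ge0.
  have [|[K [p [cK hp]]]] := IH (ltnW ij); first by left.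
  have [reg|irr] := leP (irregular_mass e eps p) (eps * #|T|%:R ^+ 2).
    left; exists K, p; split=> //.
    by rewrite cK (leq_bigmax (Ordinal (leqW ij))).
  right; exists (refine_type K), (refine e eps p); split.
    by rewrite card_refine_type cK.
  have := energy_increment e p eps0.
  have := ler_wpM2l (sqr_ge0 eps) (ltW irr).
  by rewrite -natr1; lra.
have [//|[K [p [_ hp]]]] := IH _ (leqnn j).
have := le_trans hp (energy_le R e p).
rewrite ger_pMl ?exprn_gt0 ?ltr0n //.
by rewrite leNgt hj.
Qed.

(** * Counting and removal *)

Definition update (V T : finType) (phi : {ffun V -> T}) (u : V) (x : T) :
  {ffun V -> T} := [ffun w => if w == u then x else phi w].

(** Exchanging the value of [phi] at [u] with an extra point [x] is an involution on the pairs
    [(phi, x)]: redrawing one coordinate leaves averages unchanged. *)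
Lemma resample (R : pzSemiRingType) (V T : finType) (A : V -> {set T}) (u : V)
    (H : {ffun V -> T} -> R) :
  (\sum_(phi in family A) H phi) * #|A u|%:R =
  \sum_(phi in family A) \sum_(x in A u) H (update phi u x).
Proof.
rewrite mulr_suml; under eq_bigr do rewrite mulr_natr -sumr_const.
rewrite !pair_big /=.
pose swap (z : {ffun V -> T} * T) := (update z.1 u z.2, z.1 u).
have swapK : involutive swap.
  case=> phi x; rewrite /swap /= ffunE eqxx; congr (_, _).
  by apply/ffunP => w; rewrite !ffunE; case: eqP => [->|].
rewrite (reindex_inj (inv_inj swapK)) /=; apply: eq_bigl => -[phi x] /=.
apply/andP/andP => -[/familyP fphi xA]; split.
- apply/familyP => w; have := fphi w; rewrite ffunE.
  by case: eqP => [->|].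
- by have := fphi u; rewrite ffunE eqxx.
- by apply/familyP => w; rewrite ffunE; case: eqP => [->|].
- exact: fphi.
Qed.

Lemma resample2 (R : pzSemiRingType) (V T : finType) (A : V -> {set T}) (u v : V)
    (H : {ffun V -> T} -> R) :
  (\sum_(phi in family A) H phi) * #|A v|%:R * #|A u|%:R =
  \sum_(phi in family A) \sum_(x in A u) \sum_(y in A v)
     H (update (update phi u x) v y).
Proof. by rewrite resample resample. Qed.

Section Counting.
Variables (R : realFieldType) (T V : finType) (e : rel T) (eps : R).
Variables (A : V -> {set T}) (rk : V -> nat).

Definition edge_hom (L : seq (V * V)) (phi : V -> T) : bool :=
  all (fun z => e (phi z.1) (phi z.2)) L.

Definition hom_count (L : seq (V * V)) : R :=
  \sum_(phi in family A) (edge_hom L phi)%:R.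

(** Fix all coordinates except those at [u] and [v]. Since [rk] orients each edge in only one way
    and [L] omits [(u, v)], no constraint of [L] involves both ends, so the admissible values form a
    rectangle, to which regularity applies. *)
Lemma hom_count_cons (u v : V) (L : seq (V * V)) :
    uniq ((u, v) :: L) ->
    {in (u, v) :: L, forall z, (rk z.1 < rk z.2)%N} ->
    regular e eps (A u) (A v) ->
  `|hom_count ((u, v) :: L) - dens R e (A u) (A v) * hom_count L| <=
     eps * #|family A|%:R.
Proof.
move=> /andP[uvL _] oL reg; set D := dens _ _ _ _.
have uv : u != v by apply: contraTneq (oL _ (mem_head _ _)) => -> /=; rewrite ltnn.
have [phi0 phi0P|F0] := pickP (mem (family A)); last first.
  by rewrite /hom_count !big_pred0 ?mulr0 ?subrr ?normr0 // eq_card0 ?mulr0.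
pose touches w (z : V * V) := (w == z.1) || (w == z.2).
have notboth z : z \in L -> touches v z -> ~~ touches u z.
  case: z => [a b] zL; apply/contraTN => tu; apply/negP => tv.
  have lt_ab : (rk a < rk b)%N by apply: (oL (a, b)); rewrite inE zL orbT.
  have lt_uv : (rk u < rk v)%N by apply: (oL (u, v)); apply: mem_head.
  move: tu tv; rewrite /touches /=.
  case/orP => /eqP ua; case/orP => /eqP vb; move: uv uvL lt_uv;
    rewrite ua vb ?eqxx ?zL //.
  by move=> _ _ /(ltn_trans lt_ab); rewrite ltnn.
(* Constraints touching neither [u] nor [v] are assigned to [X], which is empty if one of them
   fails. *)
pose X (phi : {ffun V -> T}) := [set x in A u | all (fun z => ~~ touches v z ==>
  e (update phi u x z.1) (update phi u x z.2)) L].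
pose Y (phi : {ffun V -> T}) := [set y in A v | all (fun z => touches v z ==>
  e (update phi v y z.1) (update phi v y z.2)) L].
have split phi x y : x \in A u -> y \in A v ->
    edge_hom L (update (update phi u x) v y) = (x \in X phi) && (y \in Y phi).
  move=> xA yA; rewrite !inE xA yA /= -all_predI; apply: eq_in_all => z zL /=.
  rewrite !ffunE; case tv: (touches v z) => /=.
    have := notboth z zL tv.
    rewrite /touches negb_or => /andP[/negbTE zu1 /negbTE zu2].
    by rewrite (eq_sym z.1 u) zu1 (eq_sym z.2 u) zu2.
  move/negbT: tv; rewrite negb_or => /andP[/negbTE zv1 /negbTE zv2].
  by rewrite andbT (eq_sym z.1 v) zv1 (eq_sym z.2 v) zv2.
have key phi : `|\sum_(x in A u) \sum_(y in A v)
    ((e x y)%:R - D) * (edge_hom L (update (update phi u x) v y))%:R| <=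
    eps * (#|A u|%:R * #|A v|%:R).
  have XA : X phi \subset A u by apply/subsetP => x; rewrite inE => /andP[].
  have YA : Y phi \subset A v by apply/subsetP => x; rewrite inE => /andP[].
  move/forallP/(_ (X phi))/forallP/(_ (Y phi)): reg; rewrite XA YA /=.
  apply: le_trans; rewrite le_eqVlt; apply/orP; left; apply/eqP.
  congr (`| _ |).
  transitivity (\sum_(x in X phi) \sum_(y in Y phi) ((e x y)%:R - D)).
    rewrite [LHS](big_setID (X phi)) /= (setIidPr XA) [X in _ + X]big1 ?addr0.
      apply: eq_bigr => x xX.
      rewrite [LHS](big_setID (Y phi)) /= (setIidPr YA) [X in _ + X]big1 ?addr0.
        apply: eq_bigr => y yY.
        by rewrite split ?(subsetP XA) ?(subsetP YA) // xX yY mulr1.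
      move=> y /setDP[yA yY].
      by rewrite split ?(subsetP XA) // (negbTE yY) andbF mulr0.
    move=> x /setDP[xA xX]; apply: big1 => y yA.
    by rewrite split // (negbTE xX) mulr0.
  under eq_bigr do rewrite sumrB sumr_const.
  by rewrite sumrB sumr_const -[_ *+ #|X phi|]mulr_natr -[_ *+ #|Y phi|]mulr_natr
     -/(nedges R e _ _) [#|X phi|%:R * _]mulrC mulrA.
have card_gt0 w : 0 < #|A w|%:R :> R.
  by rewrite ltr0n; apply/card_gt0P; exists (phi0 w); apply: (familyP phi0P).
have W0 : 0 < #|A u|%:R * #|A v|%:R :> R by rewrite mulr_gt0.
rewrite -(ler_pM2r W0) -[X in `|_| * X]gtr0_norm // -normrM.
have -> : (hom_count ((u, v) :: L) - D * hom_count L) * (#|A u|%:R * #|A v|%:R)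
  = \sum_(phi in family A) \sum_(x in A u) \sum_(y in A v)
    ((e x y)%:R - D) * (edge_hom L (update (update phi u x) v y))%:R.
  rewrite [#|A u|%:R * _]mulrC mulrA /hom_count mulr_sumr -sumrB resample2.
  apply: eq_bigr => phi _; apply: eq_bigr => x _; apply: eq_bigr => y _.
  rewrite /edge_hom /= !ffunE !eqxx (negbTE uv).
  by rewrite -mulnb natrM mulrBl.
apply: le_trans (ler_norm_sum _ _ _) _.
rewrite -mulrA mulrCA [#|family A|%:R * _]mulr_natl -sumr_const.
by apply: ler_sum => phi _; apply: key.
Qed.

(** The edges are replaced by densities one at a time, each at cost [eps * #|family A|]; densities
    are at most 1, so earlier errors do not grow. *)
Lemma counting_lemma (L : seq (V * V)) :
    0 <= eps -> uniq L -> {in L, forall z, (rk z.1 < rk z.2)%N} ->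
    {in L, forall z, regular e eps (A z.1) (A z.2)} ->
  `|hom_count L - (\prod_(z <- L) dens R e (A z.1) (A z.2)) * #|family A|%:R|
    <= (size L)%:R * eps * #|family A|%:R.
Proof.
move=> eps0; elim: L => [|[u v] L IH] uL oL rL.
  by rewrite big_nil /hom_count sumr_const mul1r subrr normr0 !mul0r.
have sub : {subset L <= (u, v) :: L} by move=> z zL; rewrite inE zL orbT.
have := hom_count_cons uL oL (rL _ (mem_head _ _)).
have {IH} := IH (andP uL).2 (sub_in1 sub oL) (sub_in1 sub rL).
rewrite big_cons /=; set P := \prod_(_ <- _) _; set D := dens _ _ _ _.
set N1 := hom_count _; set N2 := hom_count _; set W := _%:R => h1 h2.
have -> : N2 - D * P * W = (N2 - D * N1) + D * (N1 - P * W) by ring.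
apply: le_trans (ler_normD _ _) _; rewrite normrM ger0_norm ?dens_ge0 //.
have D1 : D <= 1 by apply: dens_le1.
have := ler_wpM2r (normr_ge0 (N1 - P * W)) D1.
by rewrite -natr1; lra.
Qed.

End Counting.

Definition is_hom (G : sgraph) (T : finType) (e : rel T) (phi : G -> T) : bool :=
  [forall u, forall v, adj u v ==> e (phi u) (phi v)].

Lemma is_homP (G : sgraph) (T : finType) (e : rel T) (phi : G -> T) :
  reflect (forall u v, adj u v -> e (phi u) (phi v)) (is_hom e phi).
Proof.
apply: (iffP forallP) => [h u v uv|h u].
  by move/forallP/(_ v)/implyP: (h u); apply.
by apply/forallP => v; apply/implyP; apply: h.
Qed.

Definition oriented_edges (G : sgraph) : seq (G * G) :=
  [seq z <- enum {: G * G} |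
     adj z.1 z.2 && (enum_rank z.1 < enum_rank z.2)%N].

Lemma edge_hom_oriented (G : sgraph) (T : finType) (e : rel T) (phi : G -> T) :
  symmetric e -> edge_hom e (oriented_edges G) phi = is_hom e phi.
Proof.
move=> esym; apply/allP/is_homP => [h u v uv|h z]; last first.
  by rewrite mem_filter => /andP[/andP[zadj _] _]; apply: h.
case: (ltngtP (enum_rank u) (enum_rank v)) => [lt_uv|lt_vu|].
- by apply: (h (u, v)); rewrite mem_filter /= uv lt_uv mem_enum.
- rewrite esym; apply: (h (v, u)).
  by rewrite mem_filter /= adj_sym uv lt_vu mem_enum.
- by move=> /val_inj/enum_rank_inj uv'; move: uv; rewrite uv' adj_irr.
Qed.

Lemma large_cell (T K : finType) (p : T -> K) : (0 < #|T|)%N ->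
  exists a, (#|T| <= #|K| * #|cell p a|)%N.
Proof.
case/card_gt0P => x0 _.
case: (@arg_maxnP K (p x0) xpredT (fun a => #|cell p a|) isT) => a _ ha; exists a.
rewrite -[X in (X <= _)%N]sum1_card (partition_big p predT) //= -sum_nat_const.
apply: leq_sum => b _; rewrite sum1_card; apply: leq_trans (ha b isT).
by apply: subset_leq_card; apply/subsetP => x; rewrite !inE.
Qed.

Lemma card_family_ge (R : realFieldType) (T V : finType) (A : V -> {set T}) (c : R) :
  0 <= c -> (forall u, c <= #|A u|%:R) -> c ^+ #|V| <= #|family A|%:R.
Proof.
move=> c0 hc; rewrite card_family foldrE big_map big_enum /= natr_prod.
rewrite -prodr_const; apply: ler_prod => u _.
by rewrite c0 hc.
Qed.

Section Cleaning.
Variables (R : realFieldType) (T K : finType) (e : rel T) (p : T -> K).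
Variables (eps d c : R).

Definition cleaned (x y : T) : bool :=
  let A := cell p (p x) in let B := cell p (p y) in
  [&& e x y, regular e eps A B, d <= dens R e A B, c <= #|A|%:R & c <= #|B|%:R].

Lemma cleaned_loss : 0 <= c -> 0 <= d ->
  \sum_x \sum_y (e x y && ~~ cleaned x y)%:R <=
  irregular_mass e eps p + d * #|T|%:R ^+ 2 + 2 * (#|K|%:R * c * #|T|%:R).
Proof.
move=> c0 d0.
pose small x : R := (#|cell p (p x)|%:R < c)%R%:R.
pose sparse a b : R := (dens R e (cell p a) (cell p b) < d)%R%:R.
pose irr x y : R := (~~ regular e eps (cell p (p x)) (cell p (p y)))%:R.
have small_le : \sum_x small x <= #|K|%:R * c.
  rewrite (partition_big p predT) //= mulr_natl -sumr_const.
  apply: ler_sum => a _.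
  rewrite (eq_bigr (fun=> (#|cell p a|%:R < c)%R%:R)) => [|x /eqP <- //].
  rewrite sumr_const (eq_card (_ : _ =i cell p a)) => [|x]; last by rewrite inE.
  by case: ltP => [/ltW|_]; rewrite ?mul0rn.
have irr_le : \sum_x \sum_y irr x y = irregular_mass e eps p.
  rewrite (sum_cells p); apply: eq_bigr => a _; apply: eq_bigr => b _.
  transitivity (\sum_(x in cell p a) \sum_(y in cell p b)
     ((~~ regular e eps (cell p a) (cell p b))%:R : R)).
    apply: eq_bigr => x /[!inE]/eqP xa; apply: eq_bigr => y /[!inE]/eqP yb.
    by rewrite /irr xa yb.
  rewrite !sumr_const; case: ifP => _; first by rewrite !mul0rn.
  by rewrite mulr_natl.
(* Sparsity depends on the cells only, so [e] may be replaced by the cell density, which is below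
   [d] wherever [sparse] is 1. *)
have sparse_le : \sum_x \sum_y (e x y)%:R * sparse (p x) (p y) <= d * #|T|%:R ^+ 2.
  rewrite -(sum_condexp e p sparse).
  rewrite mulrC expr2 -mulrA mulr_natl -sumr_const; apply: ler_sum => x _.
  rewrite mulr_natl -sumr_const; apply: ler_sum => y _.
  by rewrite /sparse -/(condexp R e p x y); case: ltP; rewrite ?mulr1 ?mulr0 // => /ltW.
apply: le_trans (_ : \sum_x \sum_y
    (irr x y + (e x y)%:R * sparse (p x) (p y) + small x + small y) <= _).
  apply: ler_sum => x _; apply: ler_sum => y _.
  rewrite /irr /small /sparse /cleaned; case: (e x y) => /=; last first.
    by rewrite mul0r !addr_ge0 ?ler0n.
  rewrite mul1r -natrD -natrD -natrD ler_nat !leNgt.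
  by do 4!case: (_ < _) || case: (regular _ _ _ _).
under eq_bigr do rewrite !big_split /= sumr_const.
rewrite !big_split /= sumr_const irr_le sumrMnl.
rewrite (_ : #|xpredT : pred T| = #|T|) // -[(\sum_x small x) *+ _]mulr_natr.
have := ler_wpM2r (ler0n R #|T|) small_le; lra.
Qed.

End Cleaning.

(** A single homomorphism into the cleaned relation puts the edges of [G] on regular, dense pairs of
    large cells; the counting lemma then makes a positive proportion of all maps homomorphisms into
    [e], more than [delta] allows. *)
Lemma removal_lemma (R : archiRealFieldType) (G : sgraph) (eps : R) : 0 < eps ->
  exists2 delta : R, 0 < delta &
    forall (T : finType) (e : rel T), (0 < #|T|)%N -> symmetric e ->
      #|[set phi : {ffun G -> T} | is_hom e phi]|%:R <= delta * #|T|%:R ^+ #|G| ->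
    exists e' : rel T,
      \sum_x \sum_y (e x y && ~~ e' x y)%:R <= eps * #|T|%:R ^+ 2 /\
      forall phi : G -> T, ~~ is_hom e' phi.
Proof.
move=> eps_gt0; pose L := oriented_edges G; pose m := size L.
(* The loss has four shares of at most [d * #|T| ^ 2]: one for irregular pairs, one for sparse
   pairs, two for small cells. *)
pose d : R := Num.min eps 1 / 4.
have d_gt0 : 0 < d by rewrite divr_gt0 // lt_min eps_gt0 ltr01.
have d_le : 4 * d <= eps by rewrite mulrC divfK ?pnatr_eq0 // ge_min lexx.
have d_le1 : 4 * d <= 1 by rewrite mulrC divfK ?pnatr_eq0 // ge_min lexx orbT.
have dm_gt0 : 0 < d ^+ m by apply: exprn_gt0.
(* The counting error [m * rho] is at most half of [d ^+ m], so half of the main term remains;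
   [delta] will permit only a quarter. *)
pose rho := Num.min d (d ^+ m / (2 * m.+1%:R)).
have rho_gt0 : 0 < rho by rewrite lt_min d_gt0 divr_gt0 // mulr_gt0 ?ltr0Sn.
have rho_le : m%:R * rho <= d ^+ m / 2.
  apply: (@le_trans _ _ (m.+1%:R * (d ^+ m / (2 * m.+1%:R)))).
    by rewrite ler_pM ?ler_nat // ?(ltW rho_gt0) // ge_min lexx orbT.
  by rewrite le_eqVlt; apply/orP; left; apply/eqP; field; rewrite addrC natr1 pnatr_eq0.
have [M0 hM] := szemeredi rho_gt0; pose M := M0.+1%:R : R.
have M_gt0 : 0 < M by rewrite ltr0Sn.
have dM_gt0 : 0 < d / M by rewrite divr_gt0.
exists (d ^+ m / 4 * (d / M) ^+ #|G|).
  by rewrite mulr_gt0 ?divr_gt0 // exprn_gt0.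
move=> T e T_gt0 esym few; have [K [p [cK irr]]] := hM T e.
have n_gt0 : 0 < #|T|%:R :> R by rewrite ltr0n.
pose c := d / M * #|T|%:R.
have c_gt0 : 0 < c by rewrite mulr_gt0.
have KM : #|K|%:R <= M by rewrite ler_nat (leq_trans cK).
exists (cleaned e p rho d c); split.
  have := cleaned_loss e p rho (ltW c_gt0) (ltW d_gt0).
  have : #|K|%:R * c <= d * #|T|%:R.
    rewrite /c mulrA ler_wpM2r // mulrCA -[leRHS]mulr1 ler_wpM2l ?(ltW d_gt0) //.
    by rewrite ler_pdivrMr // mul1r.
  move=> /(ler_wpM2r (ltW n_gt0)).
  have : rho <= d by rewrite ge_min lexx.
  move=> /(ler_wpM2r (sqr_ge0 #|T|%:R)).
  have := ler_wpM2r (sqr_ge0 (#|T|%:R : R)) d_le; move: irr.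
  by lra.
move=> phi; apply/negP => /is_homP hphi.
have [a0 ha0] := large_cell p T_gt0.
(* Cleaning says nothing about the cell of the image of an isolated vertex, which is therefore sent
   to a cell of at least average size. *)
pose psi u := if [exists v, adj u v] then p (phi u) else a0.
have psiE u v : adj u v -> psi u = p (phi u).
  by move=> uv; rewrite /psi ifT //; apply/existsP; exists v.
pose A u := cell p (psi u).
have big_cell u : c <= #|A u|%:R.
  rewrite /A /psi; case: existsP => [[v uv]|_].
    by case/and5P: (hphi _ _ uv).
  have : #|T|%:R <= M * #|cell p a0|%:R.
    by apply: le_trans (_ : (#|K| * #|cell p a0|)%:R <= _); rewrite ?ler_nat // natrM ler_wpM2r.
  rewrite -(ler_pM2l dM_gt0) => /le_trans; apply.
  rewrite mulrA divfK ?gt_eqF // -[leRHS]mul1r ler_wpM2r //; lra.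
have Ladj z : z \in L -> cleaned e p rho d c (phi z.1) (phi z.2) /\
    A z.1 = cell p (p (phi z.1)) /\ A z.2 = cell p (p (phi z.2)).
  rewrite mem_filter => /andP[/andP[zadj _] _]; split; first exact: hphi.
  by rewrite /A (psiE _ _ zadj) (psiE z.2 z.1) // adj_sym.
have := @counting_lemma R T G e rho A (fun u => enum_rank u) L (ltW rho_gt0).
have uL : uniq L by rewrite filter_uniq ?enum_uniq.
have oL : {in L, forall z, (enum_rank z.1 < enum_rank z.2)%N}.
  by move=> z; rewrite mem_filter => /andP[/andP[]].
have rL : {in L, forall z, regular e rho (A z.1) (A z.2)}.
  by move=> z /Ladj[/and5P[_ ? _ _ _] [-> ->]].
move=> /(_ uL oL rL); set P := \prod_(_ <- _) _.
have P_ge : d ^+ m <= P.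
  have prod_ge (s : seq (G * G)) : {subset s <= L} ->
      d ^+ size s <= \prod_(z <- s) dens R e (A z.1) (A z.2).
    elim: s => [|z s IH] sL; first by rewrite big_nil.
    have [/and5P[_ _ dz _ _] [A1 A2]] := Ladj z (sL z (mem_head _ _)).
    rewrite big_cons exprS ler_pM ?exprn_ge0 ?(ltW d_gt0) ?A1 ?A2 //.
    by apply: IH => y ys; apply: sL; rewrite inE ys orbT.
  exact: prod_ge.
have W_ge := card_family_ge (ltW c_gt0) big_cell.
set W := #|family A|%:R in W_ge *; set N := hom_count _ _ _ _.
have N_le : N <= #|[set phi : {ffun G -> T} | is_hom e phi]|%:R.
  rewrite /N /hom_count -natr_sum ler_nat -sum1_card big_mkcond [leqRHS]big_mkcond.
  apply: leq_sum => f _; rewrite inE edge_hom_oriented //.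
  by case: ifP; case: is_hom.
rewrite ler_norml => /andP[+ _].
have := ler_wpM2r (ler0n R #|family A|) rho_le.
have := ler_wpM2r (ler0n R #|family A|) P_ge; rewrite -/W.
have : 0 < d ^+ m / 4 * c ^+ #|G| by rewrite mulr_gt0 ?divr_gt0 ?exprn_gt0.
have := ler_wpM2l (ltW dm_gt0) W_ge.
have : #|[set phi : {ffun G -> T} | is_hom e phi]|%:R <= d ^+ m / 4 * c ^+ #|G|.
  by rewrite /c [X in _ <= _ * X]exprMn mulrA.
move: N_le; rewrite -/m.
by lra.
Qed.

(** * Homomorphisms into a rainbow-free family *)

Lemma set2_inj (T : finType) (x y a b : T) :
  [set x; y] = [set a; b] -> (x = a /\ y = b) \/ (x = b /\ y = a).
Proof.
move=> E; have: x \in [set a; b] by rewrite -E set21.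
have: y \in [set a; b] by rewrite -E set22.
have: a \in [set x; y] by rewrite E set21.
have: b \in [set x; y] by rewrite E set22.
rewrite !inE => /pred2P + /pred2P + /pred2P + /pred2P.
by do 4!case=> ?; subst; auto.
Qed.

Lemma edgesP (F : sgraph) (e : {set F}) :
  reflect (exists u v, adj u v /\ e = [set u; v]) (e \in edges F).
Proof.
apply: (iffP imsetP) => [[[u v] /[!inE] uv ->]|[u [v [uv ->]]]].
  by exists u, v.
by exists (u, v); rewrite ?inE.
Qed.

Lemma image_edgeP (F : sgraph) (T : finType) (f : F -> T) (e : {set T}) :
  reflect (exists u v, adj u v /\ e = [set f u; f v]) (e \in (image_of f).2).
Proof.
apply: (iffP imsetP) => [[e0 /edgesP[u [v [uv ->]]] ->]|[u [v [uv ->]]]].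
  by exists u, v; rewrite imsetU !imset_set1.
by exists [set u; v]; [apply/edgesP; exists u, v|rewrite imsetU !imset_set1].
Qed.

Lemma copiesP (F : sgraph) (T : finType) (B : subgraph T) :
  reflect (exists2 f : F -> T, injective f & B = image_of f) (B \in copies F T).
Proof.
apply: (iffP imsetP) => [[f /[!inE]/injectiveP f_inj ->]|[f f_inj ->]].
  by exists f.
have fE : [ffun x => f x] =1 f by move=> x; rewrite ffunE.
exists [ffun x => f x].
  by rewrite inE; apply/injectiveP; apply: eq_inj f_inj _ => x; rewrite ffunE.
congr (_, _); first by apply: eq_imset => x; rewrite fE.
by apply: eq_imset => e; apply: eq_imset => x; rewrite fE.
Qed.

Definition join_rel (T : finType) (C : {set subgraph T}) : rel T :=
  fun x y => [set x; y] \in union_edges C.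

Lemma join_rel_sym (T : finType) (C : {set subgraph T}) : symmetric (join_rel C).
Proof. by move=> x y; rewrite /join_rel setUC. Qed.

Lemma join_relP (T : finType) (C : {set subgraph T}) x y :
  reflect (exists2 A, A \in C & [set x; y] \in A.2) (join_rel C x y).
Proof. exact: bigcupP. Qed.

Lemma edge_disjointP (T : finType) (C : {set subgraph T}) :
  reflect (forall A B e, A \in C -> B \in C -> e \in A.2 -> e \in B.2 -> A = B)
          (edge_disjoint C).
Proof.
apply: (iffP forall_inP) => [h A B e CA CB eA eB|h A CA].
  apply/eqP; apply: contraTT isT => AB.
  have /forall_inP/(_ B CB)/implyP/(_ AB) := h A CA.
  by move=> /disjointFr/(_ eA); rewrite /sub_edges eB.
apply/forall_inP => B CB; apply/implyP => AB.
rewrite -setI_eq0; apply: contraNT AB => /set0Pn[e /setIP[eA eB]].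
by apply/eqP; apply: h eA eB.
Qed.

Definition color_at (T : finType) (C : {set subgraph T}) (x y : T) : subgraph T :=
  odflt (set0, set0) [pick A in C | [set x; y] \in A.2].

Lemma color_atP (T : finType) (C : {set subgraph T}) x y : join_rel C x y ->
  color_at C x y \in C /\ [set x; y] \in (color_at C x y).2.
Proof.
move=> /join_relP[A CA xyA]; rewrite /color_at.
by case: pickP => [B /andP[] //|/(_ A)]; rewrite CA xyA.
Qed.

(* Every homomorphism into the union of a rainbow-free family maps some vertex [w]
   into the shadow of two others: [w] either collides with [u], or is a
   vertex of the member of [C] that colors the edge [u v]. *)
Definition shadow (V T : finType) (C : {set subgraph T}) (u v : V)
    (phi : {ffun V -> T}) : {set T} :=
  phi u |: (color_at C (phi u) (phi v)).1.

Lemma hom_shadow (H G : sgraph) (T : finType) (C : {set subgraph T})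
    (phi : {ffun G -> T}) :
    ex_family H G C -> is_hom (join_rel C) phi ->
  exists u v w, [/\ w != u, w != v & phi w \in shadow C u v phi].
Proof.
move=> /and3P[CH /edge_disjointP disj /negP noG] /is_homP phi_hom.
have [phi_inj|/injectivePn[w [u wu phi_wu]]] := boolP (injectiveb phi); last first.
  by exists u, u, w; rewrite wu /shadow phi_wu setU11.
have [/existsP[[[u v] w] /and3P[wu wv hw]]|no] := boolP [exists z : G * G * G,
    [&& z.2 != z.1.1, z.2 != z.1.2 & phi z.2 \in shadow C z.1.1 z.1.2 phi]].
  by exists u, v, w.
case: noG; apply/existsP; exists (image_of phi).
rewrite imset_f ?inE //=.
pose c := [ffun E : {set T} =>
  odflt (set0, set0) [pick A in C | E \in A.2]].
have cE u v : c [set phi u; phi v] = color_at C (phi u) (phi v) by rewrite ffunE.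
apply/existsP; exists c; apply/andP; split.
  apply/forall_inP => E /image_edgeP[u [v [uv ->]]]; rewrite cE.
  by have [-> ->] := color_atP (phi_hom u v uv).
(* Take two edges of equal color. An end of the second that is not an end of the first would have
   its image in the shadow of the first, so the edges coincide. *)
apply/dinjectiveP => E1 E2 E1P E2P cE12.
have /image_edgeP[u [v [uv E1e]]] := E1P; have /image_edgeP[a [b [ab E2e]]] := E2P.
have [CA uvA] := color_atP (phi_hom u v uv).
have [_ abA] := color_atP (phi_hom a b ab).
move: cE12; rewrite E1e E2e !cE => cE12.
have inA w : w \in [set a; b] -> phi w \in (color_at C (phi u) (phi v)).1.
  have /copiesP[f _ AE] := subsetP CH _ CA.
  move: abA; rewrite -cE12 AE => /image_edgeP[x [y [xy E]]] wab.
  have : phi w \in [set f x; f y].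
    by rewrite -E; move: wab; rewrite !inE => /orP[] /eqP ->; rewrite eqxx ?orbT.
  by rewrite !inE => /orP[] /eqP ->; apply: imset_f.
have in_uv w : w \in [set a; b] -> (w == u) || (w == v).
  move=> wab; move: no; rewrite negb_exists => /forallP/(_ (u, v, w)) /=.
  rewrite /shadow in_setU1 inA // orbT andbT negb_and !negbK; exact.
have := in_uv a (set21 _ _); have := in_uv b (set22 _ _).
case/orP => /eqP bE; case/orP => /eqP aE; move: ab; rewrite aE bE ?adj_irr //.
by rewrite setUC.
Qed.

(** As [S phi] ignores the value at [w], redrawing that value hits it with probability at most
    [k / #|T|]. *)
Lemma card_self_determined (V T : finType) (w : V) (S : {ffun V -> T} -> {set T})
    (k : nat) :
    (forall phi x, S (update phi w x) = S phi) -> (forall phi, (#|S phi| <= k)%N) ->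
  (#|[set phi : {ffun V -> T} | phi w \in S phi]| * #|T| <= k * #|T| ^ #|V|)%N.
Proof.
move=> S_upd S_le.
have famT phi : (phi \in family (fun=> [set: T])) = true :> bool.
  by apply/familyP => u; rewrite inE.
have E : (#|[set phi : {ffun V -> T} | phi w \in S phi]| * #|T| =
    \sum_(phi : {ffun V -> T}) \sum_(x : T) (x \in S phi))%N.
  transitivity ((\sum_(phi : {ffun V -> T}) (phi w \in S phi)) * #|T|)%N.
    congr muln; rewrite -sum1_card big_mkcond; apply: eq_bigr => phi _.
    by rewrite inE; case: (_ \in _).
  have := @resample nat V T (fun=> [set: T]) w (fun phi => (phi w \in S phi : nat)).
  under eq_bigl do rewrite famT.
  under [RHS]eq_bigl do rewrite famT.
  rewrite natn cardsT => E; apply: etrans E _; apply: eq_bigr => phi _.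
  by apply: eq_big => [x|x _]; rewrite ?inE // ffunE eqxx S_upd.
rewrite E -card_ffun mulnC -sum_nat_const.
apply: leq_sum => phi _; apply: leq_trans (S_le phi).
rewrite -sum1_card [leqRHS]big_mkcond; apply: leq_sum => x _.
by case: (_ \in _).
Qed.

(** A union bound over the triples [(u, v, w)] of [hom_shadow]; a shadow has at most [#|H|.+1]
    points. The factor [#|T|] on the left replaces an exponent [#|G| - 1] on the right. *)
Lemma card_homs_rainbow_free (H G : sgraph) (T : finType) (C : {set subgraph T}) :
    ex_family H G C ->
  (#|[set phi : {ffun G -> T} | is_hom (join_rel C) phi]| * #|T| <=
   #|{: G * G * G}| * ((#|H|.+1) * #|T| ^ #|G|))%N.
Proof.
move=> exC.
pose bad (z : G * G * G) := [set phi : {ffun G -> T} |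
  [&& z.2 != z.1.1, z.2 != z.1.2 & phi z.2 \in shadow C z.1.1 z.1.2 phi]].
have sub : [set phi : {ffun G -> T} | is_hom (join_rel C) phi] \subset \bigcup_z bad z.
  apply/subsetP => phi; rewrite inE => /(hom_shadow exC)[u [v [w [wu wv hw]]]].
  by apply/bigcupP; exists (u, v, w); rewrite // inE wu wv hw.
apply: (leq_trans (leq_mul (subset_leq_card sub) (leqnn _))).
apply: (@leq_trans ((\sum_z #|bad z|) * #|T|)).
  rewrite leq_mul2r; apply/orP; right.
  apply: (big_ind2 (fun (A : {set _}) n => #|A| <= n)%N) => [|A m B n hA hB|//].
    by rewrite cards0.
  by apply: leq_trans (leq_add hA hB); rewrite cardsU leq_subr.
rewrite big_distrl -sum_nat_const; apply: leq_sum => -[[u v] w] _ /=.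
have [/andP[wu wv]|wuv] := boolP ((w != u) && (w != v)); last first.
  rewrite (_ : bad _ = set0) ?cards0 //; apply/setP => phi; rewrite !inE /= andbA.
  by rewrite (negbTE wuv).
pose S phi := if (#|shadow C u v phi| <= #|H|.+1)%N then shadow C u v phi else set0.
have shadow_le phi : (#|shadow C u v phi| <= #|H|.+1)%N.
  rewrite /shadow cardsU1 -add1n leq_add ?leq_b1 // /color_at.
  case: pickP => [A /andP[CA _]|_] /=; last by rewrite cards0.
  case/and3P: exC => /subsetP/(_ _ CA)/copiesP[f _ ->] _ _.
  by rewrite (leq_trans (leq_imset_card _ _)) ?max_card.
have := @card_self_determined G T w (shadow C u v) #|H|.+1 _ shadow_le.
rewrite (_ : [set phi | _] = bad (u, v, w)).
  by apply => phi x; rewrite /shadow !ffunE !(eq_sym _ w) (negbTE wu) (negbTE wv).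
by apply/setP => phi; rewrite !inE /= wu wv.
Qed.

(** For large [#|T|] the homomorphisms are few enough for the removal lemma. Members with a removed
    edge are discarded; by edge-disjointness each of them has a removed pair of its own, so few are
    lost. *)
Lemma rainbow_cleaning (R : archiRealFieldType) (H G : sgraph) (eps : R) : 0 < eps ->
  exists N : nat, forall (T : finType) (C : {set subgraph T}), (N <= #|T|)%N ->
    ex_family H G C ->
    exists C' : {set subgraph T}, [/\ C' \subset C,
      #|C|%:R <= #|C'|%:R + eps * #|T|%:R ^+ 2 &
      forall phi : G -> T, ~~ is_hom (join_rel C') phi].
Proof.
move=> eps_gt0; have [delta delta_gt0 removal] := removal_lemma G eps_gt0.
pose k := (#|{: G * G * G}| * #|H|.+1)%N.
exists (Num.bound (k%:R / delta)).+1 => T C hT exC.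
have T_gt0 : (0 < #|T|)%N by apply: leq_trans hT.
have n_gt0 : 0 < #|T|%:R :> R by rewrite ltr0n.
have hk : k%:R <= delta * #|T|%:R.
  rewrite mulrC -ler_pdivrMr //; apply: ltW.
  apply: lt_le_trans (archi_boundP _) _; first by rewrite divr_ge0 ?(ltW delta_gt0).
  by rewrite ler_nat ltnW.
have [|e' [loss e'_free]] := removal T (join_rel C) T_gt0 (join_rel_sym C).
  rewrite -(ler_pM2r n_gt0) -natrM.
  apply: le_trans (_ : (k * #|T| ^ #|G|)%:R <= _).
    by rewrite ler_nat -mulnA; apply: card_homs_rainbow_free exC.
  by rewrite natrM natrX [leRHS]mulrAC ler_wpM2r ?exprn_ge0.
pose good (A : subgraph T) := [forall x, forall y, ([set x; y] \in A.2) ==> e' x y].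
exists [set A in C | good A]; split.
- by apply/subsetP => A; rewrite inE => /andP[].
- rewrite -(cardsID [set A in C | good A] C) natrD.
  have -> : C :&: [set A in C | good A] = [set A in C | good A].
    by apply/setIidPr/subsetP => A; rewrite inE => /andP[].
  rewrite lerD2l; apply: le_trans loss.
  under eq_bigr do rewrite -natr_sum.
  rewrite -natr_sum ler_nat pair_big /=.
  pose lost := [set z : T * T | join_rel C z.1 z.2 && ~~ e' z.1 z.2].
  rewrite (_ : (\sum_p _)%N = #|lost|); last first.
    rewrite -sum1_card [RHS]big_mkcond; apply: eq_bigr => z _.
    by rewrite inE; case: ifP.
  pose wit (A : subgraph T) := [pick z : T * T | ([set z.1; z.2] \in A.2) && ~~ e' z.1 z.2].
  have witP A : A \in C :\: [set A in C | good A] ->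
      A \in C /\ exists2 z, wit A = Some z & ([set z.1; z.2] \in A.2) && ~~ e' z.1 z.2.
    rewrite !inE => /andP[+ CA]; rewrite CA /= => bad; split=> //.
    rewrite /wit; case: pickP => [z hz|no]; first by exists z.
    case/negP: bad; apply/forallP => x; apply/forallP => y; apply/implyP => xyA.
    by have := no (x, y); rewrite /= xyA => /negbFE.
  have some_inj : injective (@Some (T * T)) by move=> ? ? [].
  rewrite -(card_imset (mem lost) some_inj).
  have wit_inj : {in C :\: [set A in C | good A] &, injective wit}.
    move=> A B /witP[CA [z zA /andP[hzA _]]] /witP[CB [z' zB /andP[hzB _]]].
    rewrite zA zB => -[zz'].
    case/and3P: exC => _ /edge_disjointP disj _.
    by apply: disj CA CB hzA _; rewrite zz'.
  rewrite -(card_in_imset wit_inj); apply: subset_leq_card.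
  apply/subsetP => _ /imsetP[A /witP[CA [z -> /andP[zA ze]]] ->].
  apply: imset_f; rewrite inE ze andbT.
  by apply/join_relP; exists A.
move=> phi; apply: contra (e'_free phi) => /is_homP hphi; apply/is_homP => u v /hphi.
case/join_relP => A; rewrite inE => /andP[_ /forallP/(_ (phi u))/forallP/(_ (phi v))].
by move=> /implyP.
Qed.

(** * Packings and the multicolor Turan number *)

(** Families of copies as indexed embeddings, so that copies of [F] inside copies of [H] become
    compositions of functions. *)
Definition packing (F : sgraph) (T J : finType) (P : {set J}) (g : J -> F -> T) : Prop :=
  (forall j, j \in P -> injective (g j)) /\
  (forall i j u v u' v', i \in P -> j \in P -> adj u v -> adj u' v' ->
     [set g i u; g i v] = [set g j u'; g j v'] -> i = j).

(** [g] must have a value outside [C] as well, and for empty [C] there may be no map from [F] to [T]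
    at all; hence the first alternative. *)
Lemma packing_of_family (F : sgraph) (T : finType) (C : {set subgraph T}) :
    C \subset copies F T -> edge_disjoint C ->
  C = set0 \/ exists g : subgraph T -> F -> T,
    packing C g /\ forall A, A \in C -> image_of (g A) = A.
Proof.
move=> /subsetP CF /edge_disjointP disj.
have [->|[A0 A0C]] := set_0Vmem C; [by left|right].
have /imsetP[f0 _ _] := CF _ A0C.
pose g (A : subgraph T) : {ffun F -> T} :=
  odflt f0 [pick f : {ffun F -> T} | injectiveb f && (image_of f == A)].
have gP A : A \in C -> injective (g A) /\ image_of (g A) = A.
  move=> /CF/imsetP[f /[!inE] f_inj AE]; rewrite /g; case: pickP => [h|/(_ f)].
    by move=> /andP[/injectiveP h_inj /eqP].
  by rewrite f_inj AE eqxx.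
exists (fun A => g A); split=> [|A /gP[] //]; split=> [A /gP[] //|A B u v u' v' CA CB uv uv' E].
have edge_in A' x y : A' \in C -> adj x y -> [set g A' x; g A' y] \in A'.2.
  by move=> /gP[_ {3}<-] xy; apply/image_edgeP; exists x, y.
apply: (disj _ _ _ CA CB (edge_in A u v CA uv)).
by rewrite E; apply: edge_in.
Qed.

(** A rainbow copy of [G] becomes a homomorphism into the union once its coloring is forgotten, so
    excluding homomorphisms suffices. The edge [adj a b] prevents different indices from giving the
    same copy. *)
Lemma leq_ex_multi (F G : sgraph) (n : nat) (J : finType) (P : {set J})
    (g : J -> F -> 'I_n) (a b : F) :
    adj a b -> packing P g ->
    (forall phi : G -> 'I_n, ~ forall u v, adj u v ->
       exists j, j \in P /\ exists x y, [/\ adj x y, phi u = g j x & phi v = g j y]) ->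
  (#|P| <= ex_multi F G n)%N.
Proof.
move=> ab [g_inj g_disj] no_hom.
pose D := [set image_of (g j) | j in P].
have img_inj : {in P &, injective (fun j => image_of (g j))}.
  move=> i j iP jP E.
  have : [set g i a; g i b] \in (image_of (g j)).2.
    by rewrite -E; apply/image_edgeP; exists a, b.
  by move=> /image_edgeP[x [y [xy]]]; apply: g_disj.
rewrite -(card_in_imset img_inj); apply: leq_bigmax_cond.
apply/and3P; split.
- apply/subsetP => _ /imsetP[j jP ->]; apply/copiesP; exists (g j) => //.
  exact: g_inj.
- apply/edge_disjointP => _ _ e /imsetP[i iP ->] /imsetP[j jP ->].
  move=> /image_edgeP[x [y [xy ->]]] /image_edgeP[x' [y' [xy' E]]].
  by rewrite (g_disj i j x y x' y').
apply/existsP => -[_ /andP[/copiesP[phi phi_inj ->]]].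
move=> /existsP[c /andP[/forall_inP c_edge _]]; apply: (no_hom phi) => u v uv.
have /andP[/imsetP[j jP ->]] : (c [set phi u; phi v] \in D) &&
    ([set phi u; phi v] \in (c [set phi u; phi v]).2).
  by apply: c_edge; apply/image_edgeP; exists u, v.
move=> /image_edgeP[x [y [xy /set2_inj[[-> ->]|[-> ->]]]]]; exists j; split=> //.
  by exists x, y.
by exists y, x; rewrite adj_sym.
Qed.

(** Positivity rules out that the maximum is the default value 0 taken over no family. *)
Lemma ex_multi_attained (F G : sgraph) (n : nat) : (0 < ex_multi F G n)%N ->
  exists2 C : {set subgraph 'I_n}, ex_family F G C & #|C| = ex_multi F G n.
Proof.
move=> ex_gt0.
have [C0 C0P|no] := pickP (fun C : {set subgraph 'I_n} => ex_family F G C); last first.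
  by move: ex_gt0; rewrite /ex_multi big_pred0.
have [|C CP E] := @eq_bigmax_cond _ (fun C : {set subgraph 'I_n} => ex_family F G C)
  (fun C => #|C|).
  by apply/card_gt0P; exists C0.
by exists C.
Qed.

Lemma packing_comp (F H : sgraph) (T I J : finType) (P : {set I}) (Q : {set J})
    (g : I -> H -> T) (h : J -> F -> H) :
    packing P g -> packing Q h ->
    (forall j u v, j \in Q -> adj u v -> adj (h j u) (h j v)) ->
  packing (setX P Q) (fun z => g z.1 \o h z.2).
Proof.
move=> [g_inj g_disj] [h_inj h_disj] h_hom.
split=> [[i j] /setXP[iP jQ]|]; first by apply: inj_comp; [apply: g_inj|apply: h_inj].
move=> [i j] [i' j'] u v u' v' /setXP[iP jQ] /setXP[iP' jQ'] uv uv' /= E.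
have ii' : i = i' by apply: g_disj E => //; apply: h_hom.
subst i'; congr (_, _); apply: (h_disj j j' u v u' v') => //.
by apply: (imset_inj (g_inj i iP)); rewrite !imsetU !imset_set1.
Qed.

(** Cutting every copy of [H] into copies of [F] adds no edge to the union, so no homomorphism from
    [G] appears. *)
Lemma ex_multi_refine (F H G : sgraph) (n : nat) (C : {set subgraph 'I_n})
    (J : finType) (Q : {set J}) (h : J -> F -> H) (a b : F) :
    adj a b -> packing Q h ->
    (forall j u v, j \in Q -> adj u v -> adj (h j u) (h j v)) ->
    C \subset copies H 'I_n -> edge_disjoint C ->
    (forall phi : G -> 'I_n, ~~ is_hom (join_rel C) phi) ->
  (#|C| * #|Q| <= ex_multi F G n)%N.
Proof.
move=> ab Qh h_hom CH Cdisj no_hom.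
have [->|[g [Cg gE]]] := packing_of_family CH Cdisj; first by rewrite cards0.
rewrite -cardsX.
apply: (leq_ex_multi ab (packing_comp Cg Qh h_hom)) => phi hphi.
apply: (negP (no_hom phi)); apply/is_homP => u v /hphi.
move=> [[A j] [/setXP[CA jQ] [x [y [xy -> ->]]]]]; apply/join_relP; exists A => //=.
by rewrite -{3}(gE A CA); apply/image_edgeP; exists (h j x), (h j y); split=> //; apply: h_hom.
Qed.

(** Vertex [i] of the class of [x] is placed at [x * s + i], so division by [s] projects the
    blown-up union back to the old one. *)
Lemma ex_multi_blowup (F G : sgraph) (s m n : nat) (C : {set subgraph 'I_m}) (a b : F) :
    (0 < s)%N -> (m * s <= n)%N -> adj a b ->
    C \subset copies F 'I_m -> edge_disjoint C ->
    (forall phi : G -> 'I_m, ~~ is_hom (join_rel C) phi) ->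
  (#|C| <= ex_multi (blowup F s) G n)%N.
Proof.
move=> s_gt0 msn ab CF Cdisj no_hom.
have [->|[A0 A0C]] := set_0Vmem C; first by rewrite cards0.
have [C0|[g [[g_inj g_disj] gE]]] := packing_of_family CF Cdisj.
  by rewrite C0 inE in A0C.
have place_lt (x : 'I_m) (i : 'I_s) : (x * s + i < n)%N.
  apply: leq_trans msn; apply: leq_trans (_ : x.+1 * s <= _)%N.
    by rewrite mulSn addnC ltn_add2r.
  by rewrite leq_mul2r ltn_ord orbT.
pose place x i := Ordinal (place_lt x i).
have place_div x i : (place x i %/ s)%N = x by rewrite divnMDl // divn_small ?addn0.
have place_inj x i y j : place x i = place y j -> x = y /\ i = j.
  move=> E; have xy : x = y.
    by apply: val_inj; rewrite /= -(place_div x i) -(place_div y j) E.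
  split=> //; apply: val_inj; move: (congr1 val E); rewrite /= xy => /eqP.
  by rewrite eqn_add2l => /eqP.
pose g' (A : subgraph 'I_m) (z : blowup F s) := place (g A z.1) z.2.
have ab' : @adj (blowup F s) (a, Ordinal s_gt0) (b, Ordinal s_gt0) by [].
apply: (leq_ex_multi (g := g') ab').
  split=> [A CA [x i] [y j] /place_inj[/(g_inj A CA) /= -> ->] //|].
  move=> A B [u i] [v j] [u' i'] [v' j'] CA CB uv uv' E.
  apply: (g_disj A B u v u' v') => //.
  case: (set2_inj E) => -[/place_inj[/= -> _] /place_inj[/= -> _]] //.
  by rewrite setUC.
move=> phi hphi.
(* Vertices of [G] without neighbours may land beyond [m * s], where the quotient is not below [m];
   they get the default [g A0 a]. *)
apply: (negP (no_hom (fun u => insubd (g A0 a) (phi u %/ s)%N))); apply/is_homP => u v /hphi.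
move=> [A [CA [[x i] [[y j] [xy -> ->]]]]]; apply/join_relP; exists A => //=.
rewrite !place_div !valKd.
by rewrite -{3}(gE A CA); apply/image_edgeP; exists x, y.
Qed.

Section Littleo.
Local Open Scope classical_set_scope.

(** The remainder is one function for all [n], so by extensionality the pointwise equations amount
    to a single equation of functions. *)
Lemma ex_multi_minimalP (R : realType) (F G : sgraph) :
  ex_multi_minimal R F G <->
  forall eps : R, 0 < eps -> exists N : nat, forall n, (N <= n)%N ->
    `|(ex_multi F G n)%:R - n%:R ^+ 2 / (nverts F)%:R ^+ 2| <= eps * n%:R ^+ 2.
Proof.
pose f n : R := (ex_multi F G n)%:R.
pose g n : R := n%:R ^+ 2 / (nverts F)%:R ^+ 2; pose e n : R^o := n%:R ^+ 2.
split=> [h eps eps_gt0|h].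
  have E : f = g +o_ \oo e by apply/funext.
  move/eqaddoP/(_ eps eps_gt0): E => [N _ hN]; exists N => n Nn; have := hN n Nn.
  by rewrite /= [X in _ <= _ * X]ger0_norm // exprn_ge0.
have E : f = g +o_ \oo e.
  apply/eqaddoP => eps /h[N hN]; exists N => // n Nn.
  have := hN n Nn.
  by rewrite /= [X in _ -> _ <= _ * X]ger0_norm // exprn_ge0.
by move=> n; exact: (congr1 (@^~ n) E).
Qed.

End Littleo.

(** * Comparison of the two Turan numbers *)

(** Here [x] is [n], [y] is [n %/ s], [c] is the inverse square of [nverts F], [An] and [Am] are
    values for [F], and [B] is the value for the blow-up. In the lower bound, rounding costs
    [2 * c * x * S], a third of the error; the cleaning and the hypothesis on [F] cost the other
    two. *)
Lemma scaling_estimate (R : realFieldType) (c eps S x y An Am B : R) :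
    0 < c -> 0 < eps -> 1 <= S -> 0 <= x -> 0 <= y ->
    y * S <= x -> x <= y * S + S -> 6 * c * S <= eps * x ->
    B * S ^+ 2 <= An + eps / 3 * x ^+ 2 -> Am <= B + eps / 3 * y ^+ 2 ->
    An - x ^+ 2 * c <= eps / 3 * x ^+ 2 -> - (Am - y ^+ 2 * c) <= eps / 3 * y ^+ 2 ->
  `|B * S ^+ 2 - c * x ^+ 2| <= eps * x ^+ 2.
Proof.
move=> c_gt0 eps_gt0 S_ge1 x_ge0 y_ge0 yx xy x_big upper lower upperF lowerF.
have x2_ge0 : 0 <= eps * x ^+ 2 by rewrite mulr_ge0 ?exprn_ge0 // ltW.
apply/ler_normlP; split; last by lra.
have yS2 : x ^+ 2 - 2 * x * S <= (y * S) ^+ 2.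
  have [Sx|xS] := leP S x; last by have := sqr_ge0 (y * S); nra.
  have : (x - S) ^+ 2 <= (y * S) ^+ 2 by rewrite ler_sqr ?nnegrE; nra.
  by have := sqr_ge0 S; rewrite sqrrB; lra.
have yx2 : (y * S) ^+ 2 <= x ^+ 2 by rewrite ler_sqr ?nnegrE //; nra.
have low : c * y ^+ 2 - 2 * (eps / 3) * y ^+ 2 <= B by lra.
have := ler_wpM2r (sqr_ge0 S) low.
have := ler_wpM2l (ltW c_gt0) yS2; have := ler_wpM2l (ltW eps_gt0) yx2.
have := ler_wpM2r x_ge0 x_big.
by rewrite !exprMn; lra.
Qed.

Section Comparison.
Variables (R : realType) (F G : sgraph) (a b : F).
Hypothesis ab : adj a b.

Lemma ex_multi_upper (H : sgraph) (J : finType) (Q : {set J}) (h : J -> F -> H) (eps : R) :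
    packing Q h -> (forall j u v, j \in Q -> adj u v -> adj (h j u) (h j v)) ->
    0 < eps ->
  exists N : nat, forall n, (N <= n)%N ->
    (ex_multi H G n)%:R * #|Q|%:R <= (ex_multi F G n)%:R + eps * n%:R ^+ 2.
Proof.
move=> Qh h_hom eps_gt0; have q_gt0 : 0 < #|Q|.+1%:R :> R by rewrite ltr0Sn.
(* The loss gets multiplied by [#|Q|]; the successor in the denominator covers an empty [Q]. *)
have [N hN] := @rainbow_cleaning R H G _ (divr_gt0 eps_gt0 q_gt0).
exists N => n Nn.
have [->|] := posnP (ex_multi H G n).
  by rewrite mul0r addr_ge0 // mulr_ge0 ?exprn_ge0 // ltW.
move=> /ex_multi_attained[C exC <-].
have [|C' [/subsetP C'C C_le no_hom]] := hN _ C _ exC; first by rewrite card_ord.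
case/and3P: exC => /subsetP CH /edge_disjointP disj _.
have := @ex_multi_refine F H G n C' J Q h a b ab Qh h_hom _ _ no_hom.
rewrite -(ler_nat R) natrM.
move=> /(_ _ _)/le_trans hle.
apply: le_trans (_ : #|C'|%:R * #|Q|%:R + eps * n%:R ^+ 2 <= _).
  move: C_le; rewrite card_ord => /(ler_wpM2r (ler0n R #|Q|))/le_trans; apply.
  rewrite mulrDl lerD2l mulrAC ler_wpM2r ?exprn_ge0 // -mulrA ler_piMr ?(ltW eps_gt0) //.
  by rewrite mulrC ler_pdivrMr // mul1r ler_nat.
rewrite lerD2r; apply: hle => //.
  by apply/subsetP => A /C'C/CH.
by apply/edge_disjointP => A B e /C'C CA /C'C CB; apply: disj.
Qed.

Lemma ex_multi_lower (s : nat) (eps : R) : (0 < s)%N -> 0 < eps ->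
  exists N : nat, forall m n, (N <= m)%N -> (m * s <= n)%N ->
    (ex_multi F G m)%:R <= (ex_multi (blowup F s) G n)%:R + eps * m%:R ^+ 2.
Proof.
move=> s_gt0 eps_gt0; have [N hN] := rainbow_cleaning F G eps_gt0.
exists N => m n Nm msn.
have [->|] := posnP (ex_multi F G m).
  by rewrite addr_ge0 // mulr_ge0 ?exprn_ge0 // ltW.
move=> /ex_multi_attained[C exC <-].
have [|C' [/subsetP C'C C_le no_hom]] := hN _ C _ exC; first by rewrite card_ord.
case/and3P: exC => /subsetP CF /edge_disjointP disj _.
move: C_le; rewrite card_ord => /le_trans; apply; rewrite lerD2r ler_nat.
apply: (ex_multi_blowup s_gt0 msn ab _ _ no_hom).
  by apply/subsetP => A /C'C/CF.
by apply/edge_disjointP => A B e /C'C CA /C'C CB; apply: disj.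
Qed.

Lemma ex_multi_minimal_blowup (s : nat) (J : finType) (Q : {set J})
    (h : J -> F -> blowup F s) :
    (0 < s)%N -> packing Q h ->
    (forall j u v, j \in Q -> adj u v -> adj (h j u) (h j v)) ->
    #|Q| = (s ^ 2)%N ->
  ex_multi_minimal R F G -> ex_multi_minimal R (blowup F s) G.
Proof.
move=> s_gt0 Qh h_hom cQ /ex_multi_minimalP minF; apply/ex_multi_minimalP => eps eps_gt0.
have -> : nverts (blowup F s) = (nverts F * s)%N by rewrite /nverts card_prod card_ord.
have v_gt0 : (0 < nverts F)%N by apply/card_gt0P; exists a.
have eps3_gt0 : 0 < eps / 3 by rewrite divr_gt0.
have [N1 hN1] := minF _ eps3_gt0.
have [N2 hN2] := ex_multi_upper Qh h_hom eps3_gt0.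
have [N3 hN3] := ex_multi_lower s_gt0 eps3_gt0.
set c : R := (nverts F)%:R ^- 2 in hN1.
have c_gt0 : 0 < c by rewrite invr_gt0 exprn_gt0 // ltr0n.
pose S : R := s%:R; have S_ge1 : 1 <= S by rewrite ler1n.
have S_gt0 : 0 < S by lra.
have S2_gt0 : 0 < S ^+ 2 by apply: exprn_gt0.
pose N4 := Num.bound (6 * c * S / eps).
(* The factor [s] makes [n %/ s] reach [N1] and [N3]; [N4] makes the rounding error small. *)
exists (maxn (maxn N1 N2) (maxn (s * maxn N1 N3) N4)) => n.
rewrite !geq_max => /andP[/andP[n1 n2] /andP[n3 n4]].
pose x : R := n%:R; pose m := (n %/ s)%N; pose y : R := m%:R.
pose B : R := (ex_multi (blowup F s) G n)%:R.
have : (maxn N1 N3 <= m)%N by rewrite leq_divRL // mulnC.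
rewrite geq_max => /andP[m1 m3].
have upper := hN2 n n2; have lower := hN3 m n m3 (leq_trunc_div n s).
have /ler_normlP[_ upperF] := hN1 n n1; have /ler_normlP[lowerF _] := hN1 m m1.
have x_ge0 : 0 <= x by rewrite ler0n.
have y_ge0 : 0 <= y by rewrite ler0n.
have yx : y * S <= x by rewrite -natrM ler_nat leq_trunc_div.
have xy : x <= y * S + S by rewrite -natrM -natrD ler_nat -mulSnr ltnW // ltn_ceil.
have x_big : 6 * c * S <= eps * x.
  rewrite [leRHS]mulrC -ler_pdivrMr // (le_trans (ltW (archi_boundP _))) ?ler_nat //.
  by rewrite divr_ge0 ?mulr_ge0 ?(ltW c_gt0) ?(ltW S_gt0) ?(ltW eps_gt0).
have key : `|B * S ^+ 2 - c * x ^+ 2| <= eps * x ^+ 2.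
  apply: (scaling_estimate c_gt0 eps_gt0 S_ge1 x_ge0 y_ge0 yx xy x_big _
    lower upperF lowerF).
  by move: upper; rewrite cQ natrX.
rewrite natrM -/S exprMn -/B -/x.
have -> : B - x ^+ 2 / ((nverts F)%:R ^+ 2 * S ^+ 2) = (B * S ^+ 2 - c * x ^+ 2) / S ^+ 2.
  rewrite /c; field; rewrite !gt_eqF //=; first by rewrite ltr0n.
rewrite normrM [X in _ * X]gtr0_norm ?invr_gt0 // ler_pdivrMr //.
apply: le_trans key _; rewrite ler_peMr ?mulr_ge0 ?exprn_ge0 ?(ltW eps_gt0) //.
exact: exprn_ege1.
Qed.

End Comparison.

(** * Degenerate case: graphs [F] without edges *)

Section Edgeless.
Variables (F G : sgraph).
Hypothesis F_edgeless : forall u v : F, ~~ adj u v.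

Lemma copies_edgeless (T : finType) :
  copies F T = [set (V, set0) | V : {set T} & #|V| == nverts F].
Proof.
have no_edge (f : F -> T) : (image_of f).2 = set0.
  apply/setP => e; rewrite inE; apply/negP => /image_edgeP[u [v [uv _]]].
  by move: uv; apply/negP.
apply/setP => B; apply/copiesP/imsetP => [[f f_inj ->]|[V /[!inE]/eqP cV ->]].
  exists (f @: F); last by rewrite -(no_edge f).
  by rewrite inE card_imset.
pose f (x : F) : T := enum_val (cast_ord (esym cV) (enum_rank x)).
have f_inj : injective f by move=> x y /enum_val_inj/cast_ord_inj/enum_rank_inj.
exists f => //; rewrite [RHS]surjective_pairing no_edge; congr (_, _).
apply/esym/eqP; rewrite eqEcard card_imset // [in X in _ && X]cV leqnn andbT.
by apply/subsetP => _ /imsetP[x _ ->]; apply: enum_valP.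
Qed.

(** The union of edgeless copies has no edge and contains no [G], so all copies may be taken at
    once. *)
Lemma ex_multi_edgeless (a b : G) (n : nat) : adj a b ->
  ex_multi F G n = 'C(n, nverts F).
Proof.
move=> ab.
have <- : #|copies F 'I_n| = 'C(n, nverts F).
  by rewrite copies_edgeless card_imset ?card_draws ?card_ord // => V W [].
have no_edge A : A \in copies F 'I_n -> A.2 = set0.
  by rewrite copies_edgeless => /imsetP[V _ ->].
apply/eqP; rewrite eqn_leq; apply/andP; split.
  by apply/bigmax_leqP => C /and3P[/subset_leq_card].
apply: leq_bigmax_cond; apply/and3P; split=> //.
  by apply/edge_disjointP => A B e /no_edge ->; rewrite inE.
apply/existsP => -[_ /andP[/copiesP[phi _ ->] /existsP[c /andP[/forall_inP h _]]]].
have /h/andP[/no_edge E] : [set phi a; phi b] \in sub_edges (image_of phi).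
  by apply/image_edgeP; exists a, b.
by rewrite /sub_edges E inE.
Qed.

(** A copy of an edgeless [G] is vacuously rainbow, so even the empty family is excluded. *)
Lemma ex_multi_edgeless_target (n : nat) :
  (forall u v : G, ~~ adj u v) -> (#|G| <= n)%N -> ex_multi F G n = 0%N.
Proof.
move=> G_edgeless Gn; apply: big_pred0 => C; apply/negP => /and3P[_ _ /negP]; apply.
pose phi (x : G) : 'I_n := widen_ord Gn (enum_rank x).
have phi_inj : injective phi.
  by move=> x y xy; apply/enum_rank_inj/val_inj; apply: (congr1 val xy).
have no_edge E : E \notin sub_edges (image_of phi).
  by apply/negP => /image_edgeP[u [v [uv _]]]; move: uv; apply/negP.
apply/existsP; exists (image_of phi); apply/andP; split; first by apply/copiesP; exists phi.
apply/existsP; exists [ffun=> (set0, set0)]; apply/andP; split.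
  by apply/forall_inP => E EB; move: (no_edge E); rewrite EB.
by apply/dinjectiveP => E E' EB; move: (no_edge E); rewrite EB.
Qed.

Lemma leq_bin_shift (m j : nat) : ('C(m, 2) <= 'C(m + j, 2 + j))%N.
Proof.
elim: j => [|j IH]; first by rewrite !addn0.
by rewrite !addnS binS (leq_trans IH) // leq_addl.
Qed.

(** The true order is wrong in each case: 0 for edgeless [G], linear for one vertex, and otherwise a
    binomial coefficient whose growth exceeds the required multiple of [n ^ 2]. *)
Lemma edgeless_not_minimal (R : realType) :
  (0 < nverts F)%N -> ~ ex_multi_minimal R F G.
Proof.
move=> v_gt0 /ex_multi_minimalP minF.
have v_gt0R : 0 < (nverts F)%:R :> R by rewrite ltr0n.
have [/existsP[a /existsP[b ab]]|/existsPn G_edgeless] :=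
    boolP [exists a : G, exists b, adj a b]; last first.
  have eps_gt0 : 0 < ((nverts F)%:R ^+ 2)^-1 / 2 :> R by rewrite divr_gt0 ?invr_gt0 ?exprn_gt0.
  have [N hN] := minF _ eps_gt0.
  have := hN (N + #|G|).+1 (leqW (leq_addr _ _)).
  rewrite ex_multi_edgeless_target; last 2 first.
  - by move=> u v; move/existsPn: (G_edgeless u); apply.
  - by rewrite leqW // leq_addl.
  rewrite sub0r normrN ger0_norm ?divr_ge0 ?exprn_ge0 //.
  have : 0 < (N + #|G|).+1%:R ^+ 2 / (nverts F)%:R ^+ 2 :> R.
    by rewrite divr_gt0 ?exprn_gt0 ?ltr0Sn.
  lra.
have eps_gt0 : 0 < 16^-1 :> R by rewrite invr_gt0.
have [N minFN] := minF _ eps_gt0.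
have hN n : (N <= n)%N -> `|('C(n, nverts F))%:R - n%:R ^+ 2 / (nverts F)%:R ^+ 2|
    <= 16^-1 * n%:R ^+ 2 :> R.
  by rewrite -(ex_multi_edgeless n ab); apply: minFN.
case E : (nverts F) v_gt0 hN => [//|[|j]] _ hN.
  have := hN (N + 4)%N (leq_addr _ _).
  rewrite bin1 expr1n divr1 => /ler_normlP[+ _].
  by rewrite natrD; have := ler0n R N; nra.
(* At [n = 2k + j] with [nverts F = j + 2] the binomial is at least ['C(2k, 2)], about [2k^2], while
   [n^2 / 4] and the tolerance [n^2 / 16] together stay below [1.6 k^2]. *)
pose k := (N + 20 * j.+1)%N; pose x : R := k%:R; pose y : R := j%:R.
have := hN (k.*2 + j)%N; have nN : (N <= k.*2 + j)%N by rewrite /k; lia.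
move=> /(_ nN)/ler_normlP[_ +].
have : ('C(k.*2, 2)%:R : R) <= ('C(k.*2 + j, j.+2))%:R by rewrite ler_nat -add2n leq_bin_shift.
have -> : 'C(k.*2, 2) = (k * (k.*2).-1)%N by rewrite bin2 -doubleMl doubleK.
have k20 : 20 * (y + 1) <= x by rewrite natr1 -natrM ler_nat /k; lia.
have y0 : 0 <= y by rewrite ler0n.
have -> : (k * (k.*2).-1)%:R = x * (2 * x - 1) :> R.
  have k_gt0 : (0 < k.*2)%N by rewrite /k; lia.
  by rewrite natrM -subn1 natrB // -muln2 natrM mulrC [_ * 2]mulrC mulrC.
have nE : (k.*2 + j)%:R = 2 * x + y :> R by rewrite natrD -mul2n natrM.
have jE : j.+2%:R = y + 2 :> R by rewrite -natrD addn2.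
rewrite nE jE.
have : (2 * x + y) ^+ 2 / (y + 2) ^+ 2 <= (2 * x + y) ^+ 2 / 4.
  rewrite ler_wpM2l ?exprn_ge0 ?addr_ge0 ?mulr_ge0 //; try lra.
  by rewrite lef_pV2 ?posrE; nra.
have : (2 * x + y) ^+ 2 <= 5 * x ^+ 2 by nra.
by nra.
Qed.

(** Division by zero makes the main term 0, and the only copy is the empty one. *)
Lemma empty_minimal (R : realType) : nverts F = 0%N -> ex_multi_minimal R F G.
Proof.
move=> v0; apply/ex_multi_minimalP => eps eps_gt0.
exists (Num.bound eps^-1).+1 => n hn.
have ex1 : (ex_multi F G n <= 1)%N.
  apply/bigmax_leqP => C /and3P[/subset_leq_card CF _ _]; apply: leq_trans CF _.
  apply: leq_trans (leq_imset_card _ _) _; apply: leq_trans (max_card _) _.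
  by rewrite card_ffun -/(nverts F) v0.
rewrite v0 expr0n invr0 mulr0 subr0 ger0_norm //.
have n1 : 1 <= n%:R :> R by rewrite ler1n (leq_trans _ hn).
have en : 1 <= eps * n%:R.
  rewrite mulrC -ler_pdivrMr // div1r.
  apply: le_trans (ltW (archi_boundP _)) _; first by rewrite invr_ge0 ltW.
  by rewrite ler_nat ltnW.
have : (ex_multi F G n)%:R <= 1 :> R by rewrite lern1.
move=> /le_trans; apply; apply: (le_trans en).
by rewrite expr2 mulrA ler_peMr // (le_trans _ en).
Qed.

End Edgeless.

(** * Lines over a prime field as a packing of the blow-up *)

Section Prime.
Variables (F : sgraph) (s : nat).
Hypotheses (s_prime : prime s) (vs : (nverts F <= s)%N).

Definition line (z : 'I_s * 'I_s) (x : F) : blowup F s :=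
  (x, Ordinal (ltn_pmod (z.1 + z.2 * enum_rank x) (prime_gt0 s_prime))).

(** Subtracting the two equations cancels the intercepts and leaves the slope difference times
    [x - y]; the ranks of [x] and [y] are below [s], hence distinct in the field. *)
Lemma line_inj2 (z z' : 'I_s * 'I_s) (x y : F) :
  x != y -> line z x = line z' x -> line z y = line z' y -> z = z'.
Proof.
have natr_inj (i j : nat) : (i < s)%N -> (j < s)%N -> i%:R = j%:R :> 'F_s -> i = j.
  move=> i_s j_s /(congr1 (fun t : 'F_s => t : nat)).
  by rewrite !val_Fp_nat // !modn_small.
have modE (i j : nat) : (i %% s = j %% s)%N -> i%:R = j%:R :> 'F_s.
  by move=> E; apply: val_inj; rewrite /= !val_Fp_nat.
case: z z' => [i j] [i' j'] xy [/modE Ex] [/modE Ey]; move: Ex Ey.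
rewrite !natrD !natrM => Ex Ey.
have rank_lt (u : F) : (enum_rank u < s)%N := leq_trans (ltn_ord _) vs.
have nz : (enum_rank x)%:R - (enum_rank y)%:R != 0 :> 'F_s.
  rewrite subr_eq0; apply: contra xy => /eqP E; apply/eqP/enum_rank_inj/val_inj.
  exact: natr_inj (rank_lt x) (rank_lt y) E.
have jj : j%:R = j'%:R :> 'F_s.
  apply: (mulIf nz); apply/eqP; rewrite -subr_eq0; apply/eqP.
  transitivity ((i%:R + j%:R * (enum_rank x)%:R - (i'%:R + j'%:R * (enum_rank x)%:R))
    - (i%:R + j%:R * (enum_rank y)%:R - (i'%:R + j'%:R * (enum_rank y)%:R)) : 'F_s).
    by ring.
  by rewrite Ex Ey !subrr.
have ii : i%:R = i'%:R :> 'F_s by move: Ex; rewrite jj => /addIr.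
by congr (_, _); apply/val_inj; apply: natr_inj (ltn_ord _) (ltn_ord _) _.
Qed.

Lemma line_packing : packing [set: 'I_s * 'I_s] line.
Proof.
split=> [z _ x y [] //|z z' u v u' v' _ _ uv uv' E].
have uv_neq : u != v by apply: contraTneq uv => ->; rewrite adj_irr.
by case: (set2_inj E) => -[E1 E2]; have Eu := congr1 fst E1;
  have Ev := congr1 fst E2; rewrite /= in Eu Ev; subst u' v'; apply: line_inj2 E1 E2.
Qed.

End Prime.

(** Positivity of [k] excludes the empty family, for which no embeddings are available; the pieces
    preserve adjacency because their edges lie in [edges H]. *)
Lemma decomposable_packing (H F : sgraph) (k : nat) : (0 < k)%N ->
    decomposable H F k ->
  exists (J : finType) (Q : {set J}) (h : J -> F -> H),
    [/\ packing Q h, #|Q| = k &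
        forall j u v, j \in Q -> adj u v -> adj (h j u) (h j v)].
Proof.
move=> k_gt0 [D [DF Ddisj Dk DH]].
have [D0|[h [Dh hE]]] := packing_of_family DF Ddisj.
  by move: k_gt0; rewrite -Dk D0 cards0.
exists _, D, h; split=> // A u v AD uv.
have : [set h A u; h A v] \in edges H.
  rewrite -DH; apply/bigcupP; exists A => //; rewrite /sub_edges -{3}(hE A AD).
  by apply/image_edgeP; exists u, v.
by move=> /edgesP[x [y [xy /set2_inj[[-> ->]|[-> ->]]]]] //; rewrite adj_sym.
Qed.

Theorem theorem1p4 (R : realType) (F G : sgraph) (s : nat)
  (hs : (0 < s)%N)
  (hFG : ex_multi_minimal R F G) :
  (decomposable (blowup F s) F (s ^ 2)%N -> ex_multi_minimal R (blowup F s) G)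
  /\
  (prime s -> (nverts F <= s)%N -> ex_multi_minimal R (blowup F s) G).
Proof.
have [v0|v_gt0] := posnP (nverts F).
  have min0 : ex_multi_minimal R (blowup F s) G.
    by apply: empty_minimal; rewrite /nverts card_prod -/(nverts F) v0.
  by split.
have [/existsP[a /existsP[b ab]]|/existsPn F_edgeless] :=
    boolP [exists a : F, exists b, adj a b]; last first.
  case: (edgeless_not_minimal _ v_gt0 hFG) => u v.
  by move/existsPn: (F_edgeless u); apply.
split=> [dec|s_prime vs].
  have s2_gt0 : (0 < s ^ 2)%N by rewrite expn_gt0 hs.
  have [J [Q [h [Qh cQ h_hom]]]] := decomposable_packing s2_gt0 dec.
  exact: (ex_multi_minimal_blowup ab hs Qh h_hom cQ hFG).
apply: (ex_multi_minimal_blowup ab hs (line_packing s_prime vs) _ _ hFG).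
  by move=> j u v _.
by rewrite cardsT card_prod card_ord -mulnn.
Qed.
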